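(* Let $M\ge 1$ be an integer (an upper bound on the number of nonzeros of the binary data vectors), let $q$ be any nonzero binary query vector, with $f_q\ge1$ nonzeros, and let $0<c<1$ and $0<S_0\le\min(f_q,M)$. Then $$\rho_{MH-ALSH}^q\le\rho_{min}^q,$$ where $$\rho_{MH-ALSH}^q=\frac{\log\frac{S_0}{f_q+M-S_0}}{\log\frac{cS_0}{f_q+M-cS_0}},\qquad \rho_{min}^q=\frac{\log\frac{S_0}{f_q+M-S_0}}{\log\frac{cS_0}{f_q}} .$$
   Context: Here $S_0$ is a similarity threshold for the binary inner product (intersection size) between a query and a data vector, and $c$ is the approximation ratio. $\rho_{MH-ALSH}^q$ and $\rho_{min}^q$ are the query-dependent locality-sensitive-hashing exponents (smaller is better) of asymmetric minwise hashing and of ordinary minwise hashing, respectively, for retrieval by binary inner product; for the purposes of the statement they are given by the displayed formulas. *)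

(* Defs.v *)
From HB Require Import structures.
From mathcomp Require Import all_boot all_order all_algebra.
From mathcomp Require Import reals exp.
Set Implicit Arguments.
Unset Strict Implicit.
Unset Printing Implicit Defensive.
Import Order.TTheory GRing.Theory Num.Theory.
Local Open Scope ring_scope.

Definition nnz (D : nat) (q : 'rV[bool]_D) : nat := #|[set i | q 0 i]|.

(* The logarithms below are natural; the base cancels in the quotients. *)

Definition rho_MH_ALSH (R : realType) (M D : nat) (q : 'rV[bool]_D)
    (S0 c : R) : R :=
  let f : R := (nnz q)%:R in
  ln (S0 / (f + M%:R - S0)) / ln (c * S0 / (f + M%:R - c * S0)).

Definition rho_min (R : realType) (M D : nat) (q : 'rV[bool]_D)
    (S0 c : R) : R :=
  let f : R := (nnz q)%:R in
  ln (S0 / (f + M%:R - S0)) / ln (c * S0 / f).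

(* Main.v *)
Require Import Defs.
From HB Require Import structures.
From mathcomp Require Import all_boot all_order all_algebra.
From mathcomp Require Import reals exp.
From mathcomp Require Import lra.
Set Implicit Arguments.
Unset Strict Implicit.
Unset Printing Implicit Defensive.
Import Order.TTheory GRing.Theory Num.Theory.
Local Open Scope ring_scope.

(** Both exponents share a nonpositive numerator, so only the denominators compete. As
    [c * S0 < S0 <= M], the asymmetric one divides [c * S0] by more than [f]; its logarithm is thus
    the more negative, and the quotient the smaller. *)

Theorem theorem4 (R : realType) (M D : nat) (q : 'rV[bool]_D) (S0 c : R)
    (hM : (1 <= M)%N) (hq : q != const_mx false)
    (hc0 : 0 < c) (hc1 : c < 1)
    (hS0 : 0 < S0) (hS0le : S0 <= Num.min (nnz q)%:R M%:R) :
  rho_MH_ALSH M q S0 c <= rho_min M q S0 c.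
Proof.
move: hS0le; rewrite le_min => /andP[S0f S0M].
rewrite /rho_MH_ALSH /rho_min /=.
set f : R := (nnz q)%:R in S0f *; set m : R := M%:R in S0M *.
have cS0_gt0 : 0 < c * S0 by rewrite mulr_gt0.
have cS0_lt : c * S0 < S0 by rewrite gtr_pMl.
have f_gt0 : 0 < f by lra.
have ltfd : f < f + m - c * S0 by lra.
(* The argument is at most 1 because adding [S0 <= f] and [S0 <= m] gives [2 * S0 <= f + m]. *)
have num_le0 : ln (S0 / (f + m - S0)) <= 0.
  by apply: ln_le0; rewrite ler_pdivrMr; lra.
have lnB_lt0 : ln (c * S0 / f) < 0.
  by apply: ln_lt0; rewrite divr_gt0 //= ltr_pdivrMr // mul1r; lra.
have lnA_le : ln (c * S0 / (f + m - c * S0)) <= ln (c * S0 / f).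
  rewrite ler_ln ?posrE ?divr_gt0 //; last by lra.
  by rewrite ler_pM2l // lef_pV2 ?posrE //; lra.
(* The order flips twice: on inverting negative numbers, then on multiplying by the nonpositive
   numerator. *)
by apply: ler_wnM2l => //; rewrite lef_nV2 // negrE //; lra.
Qed.
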